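(* Let $q\geq 3$ and let $\mathcal{C}\subseteq Q^3$ be a $(3,M,q)$ code over an alphabet $Q$ with $|Q|=q$. Then $\mathcal{C}$ is a $\overline{3}$-SSC$(3,M,q)$ if and only if $\mathcal{C}$ is a $\overline{3}$-SC$(3,M,q)$.
   Context: An $(n,M,q)$ code is a set $\mathcal{C}=\{\mathbf{c}_1,\dots,\mathbf{c}_M\}\subseteq Q^n$ of $M$ distinct words (codewords), where $|Q|=q$. For $\mathcal{C}_0\subseteq\mathcal{C}$ and $1\le i\le n$, let $\mathcal{C}_0(i)=\{\mathbf{c}(i):\mathbf{c}\in\mathcal{C}_0\}$ (the set of $i$-th coordinates), and define the descendant set $\mathsf{desc}(\mathcal{C}_0)=\mathcal{C}_0(1)\times\cdots\times\mathcal{C}_0(n)$. For an integer $t\ge 2$: $\mathcal{C}$ is a $\overline{t}$-separable code ($\overline{t}$-SC$(n,M,q)$) if for any $\mathcal{C}_1,\mathcal{C}_2\subseteq\mathcal{C}$ with $1\le|\mathcal{C}_1|,|\mathcal{C}_2|\le t$ and $\mathcal{C}_1\ne\mathcal{C}_2$, we have $\mathsf{desc}(\mathcal{C}_1)\ne\mathsf{desc}(\mathcal{C}_2)$. $\mathcal{C}$ is a strongly $\overline{t}$-separable code ($\overline{t}$-SSC$(n,M,q)$) if for every $\mathcal{C}_0\subseteq\mathcal{C}$ with $1\le|\mathcal{C}_0|\le t$ we have $\bigcap_{\mathcal{C}'\in S(\mathcal{C}_0)}\mathcal{C}'=\mathcal{C}_0$, where $S(\mathcal{C}_0)=\{\mathcal{C}'\subseteq\mathcal{C}:\mathsf{desc}(\mathcal{C}')=\mathsf{desc}(\mathcal{C}_0)\}$.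 *)

(* Defs.v *)
From mathcomp Require Import all_boot.

Set Implicit Arguments.
Unset Strict Implicit.
Unset Printing Implicit Defensive.

(* Words of length n over Q are the functions {ffun 'I_n -> Q}: coordinates are
   numbered from 0 instead of 1. *)

Definition is_code (n M q : nat) (Q : finType) (C : {set {ffun 'I_n -> Q}}) : Prop :=
  #|Q| = q /\ #|C| = M.

Definition coords (n : nat) (Q : finType) (C0 : {set {ffun 'I_n -> Q}}) (i : 'I_n) : {set Q} :=
  [set c i | c : {ffun 'I_n -> Q} in C0].

Definition desc (n : nat) (Q : finType) (C0 : {set {ffun 'I_n -> Q}}) : {set {ffun 'I_n -> Q}} :=
  [set w : {ffun 'I_n -> Q} | [forall i, w i \in coords C0 i]].

Definition separable (t n : nat) (Q : finType) (C : {set {ffun 'I_n -> Q}}) : Prop :=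
  forall C1 C2 : {set {ffun 'I_n -> Q}},
    C1 \subset C -> C2 \subset C ->
    1 <= #|C1| <= t -> 1 <= #|C2| <= t ->
    C1 <> C2 -> desc C1 <> desc C2.

Definition same_desc (n : nat) (Q : finType) (C C0 : {set {ffun 'I_n -> Q}}) :
    {set {set {ffun 'I_n -> Q}}} :=
  [set C' : {set {ffun 'I_n -> Q}} | (C' \subset C) && (desc C' == desc C0)].

(* The big intersection is the full set on an empty range, but here the range
   always contains C0. *)
Definition strongly_separable (t n : nat) (Q : finType) (C : {set {ffun 'I_n -> Q}}) : Prop :=
  forall C0 : {set {ffun 'I_n -> Q}},
    C0 \subset C -> 1 <= #|C0| <= t ->
    \bigcap_(C' in same_desc C C0) C' = C0.

(* Main.v *)
Require Import Defs.
From mathcomp Require Import all_boot.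

(** Suppose C is separable, [C0 = {a, b, c}] (with b = c if C0 has two words)
    and some C' in C has the same descendants as C0 but omits a. For each
    position i, C' contains a word [d_i <> a] that agrees with a at i. A word of
    C in the descendants of two others is one of them, so [d_i] is b, c, or takes
    one coordinate from each of a, b, c. If b and c cover a at two positions,
    then [{b, c, d_i}] has the descendants of C0 for the remaining i. Two mixed
    words [d_i], [d_j] that agree at the third position k, say with c, are
    exchangeable in [{a, b, d_i}], hence equal, hence descendants of [{a, c}].
    If b covers a at exactly one position k, then a mixed [d_i] cannot take its
    coordinate k from b, as it would be a descendant of [{a, c}]; so [d_i] and
    [d_j] agree with c at k. Otherwise all three [d_i] are mixed, in the cyclic
    pattern, and [{d_0, d_1, d_2}] has the descendants of C0. *)

Set Implicit Arguments.
Unset Strict Implicit.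
Unset Printing Implicit Defensive.

Lemma mem_coords_seq (n : nat) (Q : finType) (s : seq {ffun 'I_n -> Q}) (i : 'I_n) :
  coords [set x in s] i =i [seq x i | x : {ffun 'I_n -> Q} <- s].
Proof.
move=> r; apply/imsetP/mapP => -[x xs ->]; exists x => //; first by rewrite inE in xs.
by rewrite inE.
Qed.

Lemma mem_desc (n : nat) (Q : finType) (C0 : {set {ffun 'I_n -> Q}}) (x : {ffun 'I_n -> Q}) :
  x \in C0 -> x \in desc C0.
Proof. by move=> xC; rewrite inE; apply/forallP => i; apply/imsetP; exists x. Qed.

(** Each word of [C1] is its own descendant, so [desc C2] sees all its coordinates. *)
Lemma desc_coords_sub (n : nat) (Q : finType) (C1 C2 : {set {ffun 'I_n -> Q}}) (i : 'I_n) :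
  desc C1 = desc C2 -> coords C1 i \subset coords C2 i.
Proof.
move=> E; apply/subsetP => r /imsetP[x /mem_desc]; rewrite E inE => /forallP/(_ i) h ->.
exact: h.
Qed.

(** Sequences may repeat words, so coincidences such as b = c need no separate case below. *)
Lemma separable_seq (t n : nat) (Q : finType) (C : {set {ffun 'I_n -> Q}})
    (s u : seq {ffun 'I_n -> Q}) :
  separable t C -> all (mem C) s -> all (mem C) u ->
  0 < size s <= t -> 0 < size u <= t ->
  (forall i, [seq x i | x : {ffun 'I_n -> Q} <- s] =i
             [seq x i | x : {ffun 'I_n -> Q} <- u]) ->
  s =i u.
Proof.
have card (v : seq {ffun 'I_n -> Q}) : 0 < size v <= t -> 1 <= #|[set x in v]| <= t.
  case/andP=> v0 vt; rewrite cardsE (leq_trans (card_size v) vt) andbT.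
  by case: v v0 {vt} => // x v _; rewrite (cardD1 x) mem_head.
have sub (v : seq {ffun 'I_n -> Q}) : all (mem C) v -> [set x in v] \subset C.
  by move/allP=> vC; apply/subsetP => x; rewrite inE => /vC.
move=> sep sC uC ss us E.
case: (eqVneq [set x in s] [set x in u]) => [/setP e x|/eqP ne].
  by have := e x; rewrite !inE.
case: (sep _ _ (sub _ sC) (sub _ uC) (card _ ss) (card _ us) ne).
by apply/setP => w; rewrite !inE; apply: eq_forallb => i; rewrite !mem_coords_seq E.
Qed.

Lemma eq_mem_all (T : eqType) (s u : seq T) :
  all (mem u) s -> all (mem s) u -> s =i u.
Proof. by move=> /allP su /allP us x; apply/idP/idP => [/su|/us]. Qed.

(** Adding w to [{x, y}] gives no new coordinate value, and the result still has at most three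
    words. *)
Lemma two_word_box (n : nat) (Q : finType) (C : {set {ffun 'I_n -> Q}})
    (x y w : {ffun 'I_n -> Q}) :
  separable 3 C -> x \in C -> y \in C -> w \in C ->
  (forall i, w i \in [:: x i; y i]) -> w \in [:: x; y].
Proof.
move=> sep xC yC wC box.
rewrite -(@separable_seq 3 n Q C [:: w; x; y] [:: x; y]) ?mem_head //=;
  rewrite ?xC ?yC ?wC // => i.
by apply: eq_mem_all; rewrite /= ?box !inE !eqxx ?orbT.
Qed.

(** The order of the positions records which one is copied from a, from b and from c. The lemmas
    below add that they exhaust ['I_3]. *)
Definition mixed (n : nat) (Q : finType) (C : {set {ffun 'I_n -> Q}})
    (a b c : {ffun 'I_n -> Q}) (i j k : 'I_n) : Prop :=
  exists2 d, d \in C & [/\ d \notin [:: a; b; c], d i = a i, d j = b j & d k = c k].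

Lemma mixed_swap (n : nat) (Q : finType) (C : {set {ffun 'I_n -> Q}})
    (a b c : {ffun 'I_n -> Q}) (i j k : 'I_n) :
  mixed C a b c i j k -> mixed C a c b i k j.
Proof.
by case=> d dC [dN di dj dk]; exists d => //; split=> //; move: dN; rewrite !inE (orbC (d == b)).
Qed.

(** Otherwise d would take all its coordinates from a and c. *)
Lemma mixed_neq (Q : finType) (C : {set {ffun 'I_3 -> Q}})
    (a b c : {ffun 'I_3 -> Q}) (i j k : 'I_3) :
  separable 3 C -> a \in C -> c \in C -> [:: i; j; k] =i 'I_3 ->
  mixed C a b c i j k -> a j <> b j.
Proof.
move=> sep aC cC ijk [d dC [dN di dj dk]] ab.
have: d \in [:: a; c].
  apply: (two_word_box sep) => // l; have: l \in [:: i; j; k] by rewrite ijk.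
  by rewrite !inE => /or3P[] /eqP->; rewrite ?di ?dj ?dk ?ab eqxx ?orbT.
by move: dN; rewrite !inE => /norP[/negPf-> /norP[_ /negPf->]].
Qed.

Lemma mixed_exchange (Q : finType) (C : {set {ffun 'I_3 -> Q}})
    (a b c : {ffun 'I_3 -> Q}) (i j k : 'I_3) :
  separable 3 C -> a \in C -> b \in C -> c \in C -> [:: i; j; k] =i 'I_3 ->
  mixed C a b c i j k -> mixed C a b c j i k -> False.
Proof.
move=> sep aC bC cC ijk [d dC [dN di dj dk]] [e eC [eN ej ei ek]].
have: d \in [:: e; a; b].
  rewrite -(@separable_seq 3 3 Q C [:: d; a; b] [:: e; a; b]) ?mem_head //=;
    rewrite ?aC ?bC ?dC ?eC // => l.
  have: l \in [:: i; j; k] by rewrite ijk.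
  by rewrite !inE => /or3P[] /eqP->; apply: eq_mem_all;
    rewrite /= !inE ?di ?dj ?dk ?ei ?ej ?ek !eqxx ?orbT.
rewrite inE => /orP[/eqP de | dab]; last by move: dN dab; rewrite !inE orbA => /norP[/negPf->].
have: d \in [:: a; c].
  apply: (two_word_box sep) => // l; have: l \in [:: i; j; k] by rewrite ijk.
  by rewrite !inE => /or3P[] /eqP->; rewrite ?di ?dk 1?de ?ej ?eqxx ?orbT.
by move: dN; rewrite !inE => /norP[/negPf-> /norP[_ /negPf->]].
Qed.

(** At each position the three mixed words carry the values of a, b, c in some order, as in a Latin
    square. *)
Lemma mixed_cyclic (Q : finType) (C : {set {ffun 'I_3 -> Q}})
    (a b c : {ffun 'I_3 -> Q}) (i j k : 'I_3) :
  separable 3 C -> a \in C -> b \in C -> c \in C -> [:: i; j; k] =i 'I_3 ->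
  mixed C a b c i j k -> mixed C a b c j k i -> mixed C a b c k i j -> False.
Proof.
move=> sep aC bC cC ijk [d dC [dN di dj dk]] [e eC [_ ej ek ei]] [f fC [_ fk fi fj]].
move/negP: dN; apply.
rewrite -(@separable_seq 3 3 Q C [:: d; e; f] [:: a; b; c]) ?mem_head //=;
  rewrite ?aC ?bC ?cC ?dC ?eC ?fC // => l.
have: l \in [:: i; j; k] by rewrite ijk.
by rewrite !inE => /or3P[] /eqP->; apply: eq_mem_all;
  rewrite /= !inE ?di ?dj ?dk ?ei ?ej ?ek ?fi ?fj ?fk !eqxx ?orbT.
Qed.

(** Replace a by d in [{a, b, c}]: d restores the value at i, b and c supply those at j and k, and
    [box] excludes new values. *)
Lemma covered_two (Q : finType) (C : {set {ffun 'I_3 -> Q}})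
    (a b c d : {ffun 'I_3 -> Q}) (i j k : 'I_3) :
  separable 3 C -> a \in C -> b \in C -> c \in C -> d \in C ->
  [:: i; j; k] =i 'I_3 -> a \notin [:: b; c] -> d != a -> d i = a i ->
  (forall l, d l \in [:: a l; b l; c l]) ->
  a j \in [:: b j; c j] -> a k \in [:: b k; c k] -> False.
Proof.
move=> sep aC bC cC dC ijk aN da di box aj ak.
have: a \in [:: d; b; c].
  rewrite -(@separable_seq 3 3 Q C [:: a; b; c] [:: d; b; c]) ?mem_head //=;
    rewrite ?aC ?bC ?cC ?dC // => l.
  apply: eq_mem_all; rewrite /= ?box !inE !eqxx ?orbT //= !andbT.
  have: l \in [:: i; j; k] by rewrite ijk.
  by rewrite !inE in aj ak *; case/or3P => /eqP->; rewrite ?di ?aj ?ak ?eqxx ?orbT.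
by rewrite inE eq_sym (negPf da) (negPf aN).
Qed.

Lemma covered_or_mixed (Q : finType) (C : {set {ffun 'I_3 -> Q}})
    (a b c d : {ffun 'I_3 -> Q}) (i j k : 'I_3) :
  separable 3 C -> a \in C -> b \in C -> c \in C -> d \in C ->
  [:: i; j; k] =i 'I_3 -> d != a -> d i = a i ->
  (forall l, d l \in [:: a l; b l; c l]) ->
  [\/ a i = b i, a i = c i, mixed C a b c i j k | mixed C a b c i k j].
Proof.
move=> sep aC bC cC dC ijk da di box.
have [E|db] := eqVneq d b; first by constructor 1; rewrite -di E.
have [E|dc] := eqVneq d c; first by constructor 2; rewrite -di E.
have dN : d \notin [:: a; b; c] by rewrite !inE !negb_or da db.
have two x y : x \in C -> y \in C -> x \in [:: a; b; c] -> y \in [:: a; b; c] ->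
    d i \in [:: x i; y i] -> d j \in [:: x j; y j] -> d k \in [:: x k; y k] -> False.
  move=> xC yC xs ys hi hj hk.
  have: d \in [:: x; y].
    apply: (two_word_box sep) => // l; have: l \in [:: i; j; k] by rewrite ijk.
    by rewrite !inE => /or3P[] /eqP->; move: hi hj hk; rewrite !inE.
  by rewrite !inE => /orP[]/eqP E; rewrite E ?xs ?ys in dN.
have Mb : d j = b j -> d k = c k -> mixed C a b c i j k by exists d.
have Mc : d k = b k -> d j = c j -> mixed C a b c i k j by exists d.
(* Of the nine origins of [d j] and [d k], two use both b and c; the other seven leave d in the box
   of a and one other word. *)
have := box j; have := box k; rewrite !inE => /or3P[] /eqP dk /or3P[] /eqP dj;
  try (by constructor 3; apply: Mb); try (by constructor 4; apply: Mc);
  exfalso;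
  [apply: (two a b) | apply: (two a b) | apply: (two a c) | apply: (two a b)
  |apply: (two a b) | apply: (two a c) | apply: (two a c)];
  by rewrite ?inE ?di ?dj ?dk ?eqxx ?orbT.
Qed.

(** The refuted condition is what a set with the descendants of [{a, b, c}] but without a would
    provide. *)
Lemma no_replacement (Q : finType) (C : {set {ffun 'I_3 -> Q}})
    (a b c : {ffun 'I_3 -> Q}) :
  separable 3 C -> a \in C -> b \in C -> c \in C -> a \notin [:: b; c] ->
  ~ (forall i, exists2 d, d \in C &
       [/\ d != a, d i = a i & forall l, d l \in [:: a l; b l; c l]]).
Proof.
move=> sep aC bC cC aN D.
pose span i j k := [:: i; j; k] =i 'I_3.
have T i j k : span i j k ->
    (a j = b j \/ a j = c j) -> (a k = b k \/ a k = c k) -> False.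
  have cov l : (a l = b l \/ a l = c l) -> a l \in [:: b l; c l].
    by rewrite !inE => -[]->; rewrite eqxx ?orbT.
  move=> ijk /cov aj /cov ak; case: (D i) => d dC [da di box].
  exact: (covered_two sep aC bC cC dC ijk).
have K i j k : span i j k ->
    [\/ a i = b i, a i = c i, mixed C a b c i j k | mixed C a b c i k j].
  by move=> ijk; case: (D i) => d dC [da di box]; apply: (covered_or_mixed sep _ _ _ dC ijk).
have swap i j k : span i j k -> span i k j.
  by move=> ijk l; rewrite -ijk !inE (orbC (l == k)).
have N i j k : span i j k -> mixed C a b c i j k -> a j <> b j /\ a k <> c k.
  move=> ijk m; split; first exact: (mixed_neq sep aC cC ijk m).
  exact: (mixed_neq sep aC bC (swap _ _ _ ijk) (mixed_swap m)).
have X i j k : span i j k -> mixed C a b c i j k -> mixed C a b c j i k -> False.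
  by move=> ijk; apply: mixed_exchange.
have X' i j k : span i j k -> mixed C a b c i k j -> mixed C a b c j k i -> False.
  by move=> ijk /mixed_swap m /mixed_swap; apply: (mixed_exchange sep aC cC bC ijk m).
have Y i j k : span i j k ->
    mixed C a b c i j k -> mixed C a b c j k i -> mixed C a b c k i j -> False.
  by move=> ijk; apply: mixed_cyclic.
have [i [j [k ijk]]] : exists i j k, span i j k.
  exists ord0, (inord 1), (inord 2) => l; rewrite !inE -!val_eqE /= !inordK //.
  by case: l => -[|[|[|]]].
have jki : span j k i by move=> l; rewrite -ijk !inE orbA orbC.
have kij : span k i j by move=> l; rewrite -jki !inE orbA orbC.
(* The rotations and their swaps are all six orders of the positions; what remains is
   propositional. *)
have := (T _ _ _ ijk, T _ _ _ jki, T _ _ _ kij).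
have := (Y _ _ _ ijk, Y _ _ _ (swap _ _ _ ijk)).
have := (X _ _ _ ijk, X _ _ _ jki, X _ _ _ kij, X' _ _ _ ijk, X' _ _ _ jki, X' _ _ _ kij).
have := (N _ _ _ ijk, N _ _ _ jki, N _ _ _ kij).
have := (N _ _ _ (swap _ _ _ ijk), N _ _ _ (swap _ _ _ jki), N _ _ _ (swap _ _ _ kij)).
move: (K _ _ _ ijk) (K _ _ _ jki) (K _ _ _ kij); clear.
by case=> ?; case=> ?; case=> ?; tauto.
Qed.

Theorem theorem1 (q M : nat) (Q : finType) (C : {set {ffun 'I_3 -> Q}}) :
  3 <= q -> is_code M q C ->
  (strongly_separable 3 C <-> separable 3 C).
Proof.
move=> _ _; split=> [ssep C1 C2 C1C C2C s1 s2 ne E | sep C0 C0C /andP[_ C0_le]].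
  (* Equal descendants give the same family [same_desc], hence the same intersection. *)
  apply: ne; rewrite -(ssep _ C1C s1) -(ssep _ C2C s2).
  by apply: eq_bigl => C'; rewrite !inE E.
apply/setP/subset_eqP/andP; split.
  by apply: bigcap_inf; rewrite inE C0C eqxx.
apply/bigcapsP => C'; rewrite inE => /andP[C'C /eqP E]; apply/subsetP => a aC0.
have repl i : exists2 d, d \in C' & d i = a i /\ forall l, exists2 x, x \in C0 & d l = x l.
  have /imsetP[d dC' ->] : a i \in coords C' i.
    by apply: (subsetP (desc_coords_sub i (esym E))); apply/imsetP; exists a.
  exists d => //; split=> // l; apply/imsetP/(subsetP (desc_coords_sub l E)).
  by apply/imsetP; exists d.
apply/negPn/negP => aC'.
have no_triple b c : b \in C0 :\ a -> c \in C0 :\ a ->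
    {subset C0 <= [:: a; b; c]} -> False.
  move=> /setD1P[ba /(subsetP C0C) bC] /setD1P[ca /(subsetP C0C) cC] sub.
  apply: (@no_replacement Q C a b c) => //; first exact: (subsetP C0C).
    by rewrite !inE negb_or eq_sym ba eq_sym.
  move=> i; have [d dC' [di box]] := repl i; exists d; first exact: (subsetP C'C).
  split=> //; first by apply: contraNneq aC' => <-.
  move=> l; have [x /sub xs ->] := box l; exact: (map_f (fun y : {ffun _} => y l) xs).
have C0E x : x \in C0 -> x \in a :: enum (C0 :\ a).
  by rewrite inE mem_enum !inE; case: eqP.
have memD x : x \in enum (C0 :\ a) -> x \in C0 :\ a by rewrite mem_enum.
have : size (enum (C0 :\ a)) <= 2 by rewrite -cardE; rewrite (cardsD1 a) aC0 in C0_le.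
case: (enum _) C0E memD => [|b [|c [|]]] // C0E memD _.
(* If [C0] is [{a}], any such d equals a, at whatever position it was chosen. *)
- have [d dC' [_ box]] := repl ord0; case/negP: aC'; suff <- : d = a by [].
  by apply/ffunP => l; have [x /C0E] := box l; rewrite inE => /eqP->.
(* Two words are treated as a triple with b = c. *)
- apply: (no_triple b b); rewrite ?memD ?mem_head // => x /C0E.
  by rewrite !inE orbb.
- by apply: (no_triple b c); rewrite ?memD ?inE ?eqxx ?orbT.
Qed.
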